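(* For every $p \geq 1$ there exists a deterministic online algorithm for load balancing of temporary tasks with predicted durations on unrelated machines which is $O\left(\mu\,(p+\log(\mu \tilde{D}))\right)$-competitive for the $\ell_p$-norm objective. In particular, for the $\ell_\infty$-norm objective there exists an $O\left(\mu \log(m\mu\tilde{D})\right)$-competitive online algorithm.
   Context: Load balancing of temporary tasks with predictions: there are $m$ machines. Jobs arrive online at integer time steps $t=0,1,\dots,T-1$ (several jobs may arrive at the same time, in arbitrary order). Job $j$ has an arrival time $t_j$, an actual integer duration $d_j\in\{1,\dots,D\}$, and a load $p_{ij}\in\mathbb{R}_+\cup\{\infty\}$ if assigned to machine $i$; it is alive during time slots $t_j+1,\dots,t_j+d_j$. Upon arrival of job $j$ the algorithm learns $t_j$, the loads $p_{ij}$ and a (possibly inaccurate) real estimate $\tilde d_j\ge 1$ of its duration, but not $d_j$, and must irrevocably assign $j$ to one machine. Let $\tilde D=\max_j \tilde d_j$. Let $\mu_1,\mu_2\ge 1$ be such that for all jobs $d_j\in[\lceil \tilde d_j/\mu_2\rceil,\lfloor \mu_1\tilde d_j\rfloor]$, and let $\mu=\mu_1\mu_2$ (the distortion). The parameters $\mu_1,\mu_2,D,\tilde D$ are not known to the algorithm in advance. The load of machine $i$ at time slot $t$ is $\ell_i(t)=\sum p_{ij}$ over jobs $j$ assigned to $i$ that are alive at $t$, and $\ell(t)=(\ell_1(t),\dots,\ell_m(t))$. The objective is to minimize $\max_t \|\ell(t)\|_p$, where $\|x\|_p=(\sum_i x_i^p)^{1/p}$ and $\|x\|_\infty=\max_i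 x_i$. An online algorithm is $c$-competitive if on every input its objective value is at most $c$ times that of an optimal offline assignment (which knows all jobs and their actual durations); here $c$ may depend on the parameters $\mu,\tilde D,m,p$ of the input.
   Formalization: In the ℓ∞ bound, log(mμD̃) is read as max(1, log(mμD̃)), since for m=μ=D̃=1 the logarithm is 0 and no algorithm is 0-competitive; the online algorithm may observe the durations of jobs that have already departed. *)

(* Defs.v *)
From HB Require Import structures.
From mathcomp Require Import all_boot all_order all_algebra.
From mathcomp Require Import all_classical all_reals all_analysis.

Set Implicit Arguments.
Unset Strict Implicit.
Unset Printing Implicit Defensive.

Import Order.TTheory GRing.Theory Num.Theory.

Local Open Scope ring_scope.

(* The duration estimate is a real number; the load on a machine may be +oo. *)
Record job (R : realType) (m : nat) := Job {
  arrival : nat;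
  duration : nat;
  estimate : R;
  load : 'I_m -> \bar R
}.

(* Jobs are numbered in the order in which they are presented. *)
Record instance (R : realType) (m : nat) := Instance {
  horizon : nat;
  max_duration : nat;
  njobs : nat;
  jobs : 'I_njobs -> job R m
}.

Arguments jobs {R m} i _.

Definition valid_instance (R : realType) (m : nat) (I : instance R m) : Prop :=
  [/\ forall j, (arrival (jobs I j) < horizon I)%N,
      forall j k : 'I_(njobs I),
        (j <= k)%N -> (arrival (jobs I j) <= arrival (jobs I k))%N,
      forall j, (1 <= duration (jobs I j) <= max_duration I)%N,
      forall j, 1 <= estimate (jobs I j)
    & forall j i, (0 <= load (jobs I j) i)%E].

(* mu1 and mu2 bound the under- and over-estimation factors. *)
Definition distortion_bounds (R : realType) (m : nat) (I : instance R m)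
    (mu1 mu2 : R) : Prop :=
  [/\ 1 <= mu1, 1 <= mu2 &
    forall j, let J := jobs I j in
      Num.ceil (estimate J / mu2) <= (duration J)%:Z
        <= Num.floor (mu1 * estimate J)].

(* Estimates are at least 1, so the default value 1 only matters when there
   are no jobs. *)
Definition max_estimate (R : realType) (m : nat) (I : instance R m) : R :=
  \big[Num.max/1]_(j < njobs I) estimate (jobs I j).

Definition alive (R : realType) (m : nat) (J : job R m) (t : nat) : bool :=
  ((arrival J).+1 <= t <= arrival J + duration J)%N.

Definition machine_load (R : realType) (m : nat) (I : instance R m)
    (a : 'I_(njobs I) -> 'I_m) (t : nat) (i : 'I_m) : \bar R :=
  (\sum_(j < njobs I | (a j == i) && alive (jobs I j) t) load (jobs I j) i)%E.

Definition lp_norm (R : realType) (m : nat) (p : R) (x : 'I_m -> \bar R) :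
    \bar R :=
  ((\sum_(i < m) x i `^ p) `^ p^-1)%E.

(* Used for nonnegative vectors only, hence the default value 0. *)
Definition linf_norm (R : realType) (m : nat) (x : 'I_m -> \bar R) : \bar R :=
  (\big[maxe/0]_(i < m) x i)%E.

(* No job is alive outside the time slots 1, ..., horizon + max_duration - 1. *)
Definition objective (R : realType) (m : nat)
    (norm : ('I_m -> \bar R) -> \bar R) (I : instance R m)
    (a : 'I_(njobs I) -> 'I_m) : \bar R :=
  (\big[maxe/0]_(1 <= t < horizon I + max_duration I)
     norm (machine_load a t))%E.

Definition opt (R : realType) (m : nat) (norm : ('I_m -> \bar R) -> \bar R)
    (I : instance R m) : \bar R :=
  (\big[mine/+oo]_(a : {ffun 'I_(njobs I) -> 'I_m}) objective norm a)%E.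

(* What is known about a job at some point in time: the data revealed on its
   arrival and, once the job has departed, its actual duration. *)
Record observation (R : realType) (m : nat) := Observation {
  obs_arrival : nat;
  obs_estimate : R;
  obs_load : 'I_m -> \bar R;
  obs_duration : option nat
}.

Definition observe (R : realType) (m : nat) (now : nat) (J : job R m) :
    observation R m :=
  Observation (arrival J) (estimate J) (@load R m J)
    (if (arrival J + duration J <= now)%N then Some (duration J) else None).

(* A deterministic online algorithm maps the observations of all jobs presented
   so far, the last of which is the job to be assigned, to a machine.  Its own
   earlier decisions are determined by these observations. *)
Definition online_algorithm (R : realType) (m : nat) : Type :=
  seq (observation R m) -> 'I_m.

Definition run (R : realType) (m : nat) (alg : online_algorithm R m)
    (I : instance R m) (j : 'I_(njobs I)) : 'I_m :=
  alg [seq observe (arrival (jobs I j)) (jobs I k)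
      | k : 'I_(njobs I) <- enum 'I_(njobs I) & (k <= j)%N].

(* The ratio c is a function of the distortion and of the largest estimate;
   the algorithm is given neither of them. *)
Definition competitive (R : realType) (m : nat)
    (norm : ('I_m -> \bar R) -> \bar R) (alg : online_algorithm R m)
    (c : R -> R -> R) : Prop :=
  forall (I : instance R m) (mu1 mu2 : R),
    valid_instance I -> distortion_bounds I mu1 mu2 ->
    (objective norm (run alg (I := I))
      <= (c (mu1 * mu2) (max_estimate I))%:E * opt norm I)%E.

(* Main.v *)
(** A job is planned to last for a power of two that is at least [2 ^ g] times
its estimate, where [2 ^ g] is a guess of [mu1] that is raised as soon as some
job is seen to outlive it.  Jobs are divided into groups by their guess, by the
size class of their planned duration (the logarithms of the class bounds
double), and by arrival block, the blocks being as long as the class bound.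
Within a group a job goes to the machine where [sum_t ||l(t)||_p ^ q] over its
planned slots grows least, with [q] about [p] plus the logarithm of the class
bound.

The planned load of the earlier jobs is nonincreasing in the slots after an
arrival, and the increments of [||.||_p ^ q] increase with the load since
[q >= p].  So the increment summed over the planned slots is at most
[lambda = 2 * 2 ^ g * mu2] times its sum over the slots in which the job is
really alive.  Against an offline assignment with loads [o] this gives
[sum_t ||l||^q <= lambda * sum_t (||l + o||^q - ||l||^q)], hence
[max_t ||l(t)|| <= 8 lambda q * max_t ||o(t)||] because [q] exceeds the
logarithm of the number of slots.  At any time every guess and class contribute
two blocks, and the bounds form geometric series in the guess and in the
class. *)

Require Import Defs.
From HB Require Import structures.
From mathcomp Require Import all_boot all_order all_algebra.
From mathcomp Require Import all_classical all_reals all_analysis.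
From mathcomp Require Import zify ring lra.

Set Implicit Arguments.
Unset Strict Implicit.
Unset Printing Implicit Defensive.

Import Order.TTheory GRing.Theory Num.Theory.

Local Open Scope ring_scope.

(** * Real inequalities *)

Section RealInequalities.
Variable R : realType.
Implicit Types (f : R -> R) (r u v d e : R).

Lemma ler_powR_base r u v : 0 <= r -> 0 <= u -> u <= v -> u `^ r <= v `^ r.
Proof. by move=> r0 u0 uv; rewrite ge0_ler_powR ?nnegrE // (le_trans u0). Qed.

Lemma convex_increment_le f u v d :
  convex_function (`[0, +oo[%classic : set R) f ->
  0 <= u -> u <= v -> 0 <= d -> f (u + d) - f u <= f (v + d) - f v.
Proof.
move=> cvxf u0 uv d0; have [vdu|vdu] := eqVneq (v + d - u) 0.
  by have -> : v = u by lra.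
have vdu0 : 0 < v + d - u by rewrite lt_neqAle eq_sym vdu; lra.
have cvx t : 0 <= t <= 1 ->
    f (t * (v + d) + (1 - t) * u) <= t * f (v + d) + (1 - t) * f u.
  move=> /andP[t0 t1]; have := cvxf (Itv01 t0 t1) (v + d) u.
  by rewrite !inE /= !in_itv /= !andbT !convRE; apply; lra.
pose t := d / (v + d - u).
have t01 : 0 <= t <= 1 by rewrite divr_ge0 ?ler_pdivrMr //=; lra.
have ud : u + d = t * (v + d) + (1 - t) * u by rewrite /t; field.
have vE : v = (1 - t) * (v + d) + (1 - (1 - t)) * u by rewrite /t; field.
have fud := cvx t t01; rewrite -ud in fud.
have t01' : 0 <= 1 - t <= 1 by lra.
have fv := cvx (1 - t) t01'; rewrite -vE in fv.
lra.
Qed.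

Lemma powR_increment_le r u v d e : 1 <= r -> 0 <= u -> u <= v -> 0 <= d ->
  d <= e -> (u + d) `^ r - u `^ r <= (v + e) `^ r - v `^ r.
Proof.
move=> r1 u0 uv d0 de.
apply: (le_trans (convex_increment_le (convex_powR r1) u0 uv d0)).
by rewrite lerD2r; apply: ler_powR_base; lra.
Qed.

Lemma expr_increment_le (q : nat) u v : 0 <= u -> u <= v ->
  v ^+ q - u ^+ q <= q%:R * (v - u) * v ^+ q.-1.
Proof.
move=> u0 uv; have v0 := le_trans u0 uv.
rewrite subrXX [q%:R * _]mulrC -mulrA ler_wpM2l ?subr_ge0 //.
rewrite mulr_natl -[X in _ *+ X](card_ord q) -sumr_const; apply: ler_sum => i _.
have -> : v ^+ q.-1 = v ^+ (q.-1 - i) * v ^+ i.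
  by rewrite -exprD subnK //; have := ltn_ord i; lia.
by rewrite ler_wpM2l ?exprn_ge0 ?lerXn2r.
Qed.

(* If [u + d >= 4 l q d], the increment is at most a quarter of the power
   [(u + d) ^+ q]; otherwise the power itself is at most [(4 l q d) ^+ q]. *)
Lemma scaled_increment_le (q : nat) l u d : (0 < q)%N -> 1 <= l -> 0 <= u ->
  0 <= d ->
  l * ((u + d) ^+ q - u ^+ q) <= u ^+ q / 2 + (4 * l * q%:R * d) ^+ q.
Proof.
move=> q0 l1 u0 d0; set s := 4 * l * q%:R * d; set v := u + d.
have v0 : 0 <= v by rewrite addr_ge0.
have s0 : 0 <= s by rewrite !mulr_ge0 //; lra.
have uq0 : 0 <= u ^+ q by exact: exprn_ge0.
have vq0 : 0 <= v ^+ q by exact: exprn_ge0.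
have sq0 : 0 <= s ^+ q by exact: exprn_ge0.
have vq'0 : 0 <= v ^+ q.-1 by exact: exprn_ge0.
have exprE x : x ^+ q = x * x ^+ q.-1 by rewrite -exprS prednK.
have incr_le : l * (v ^+ q - u ^+ q) <= s * v ^+ q.-1 / 4.
  have uv : u <= v by rewrite lerDl.
  rewrite (_ : _ / 4 = l * (q%:R * (v - u) * v ^+ q.-1)).
    by rewrite ler_wpM2l ?expr_increment_le //; lra.
  by rewrite /s /v; field.
have [sv|vs] := leP s v.
  have sv_le : s * v ^+ q.-1 <= v ^+ q by rewrite exprE ler_wpM2r.
  have l0 : 0 < l by lra.
  have : v ^+ q - u ^+ q <= v ^+ q / 4.
    rewrite -(ler_pM2l l0); apply: (le_trans incr_le).
    have : v ^+ q <= l * v ^+ q by rewrite ler_peMl.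
    lra.
  lra.
have : s * v ^+ q.-1 <= s ^+ q.
  by rewrite exprE ler_wpM2l // lerXn2r ?nnegrE // ltW.
lra.
Qed.

Lemma nonincreasing_sum_average (g : nat -> R) (b d e : nat) : (e <= d)%N ->
  (forall s t, (b <= s <= t)%N -> g t <= g s) ->
  e%:R * \sum_(b <= t < b + d) g t <= d%:R * \sum_(b <= t < b + e) g t.
Proof.
move=> ed gni.
have tail : \sum_(b + e <= t < b + d) g t <= (d%:R - e%:R) * g (b + e)%N.
  rewrite -natrB // mulr_natl -[(d - e)%N](subnDl b) -sumr_const_nat.
  by apply: ler_sum_nat => t /andP[? _]; apply: gni; lia.
have head : e%:R * g (b + e)%N <= \sum_(b <= t < b + e) g t.
  rewrite mulr_natl -[X in _ *+ X](addKn b) -sumr_const_nat.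
  by apply: ler_sum_nat => t ?; apply: gni; lia.
rewrite (@big_cat_nat _ _ _ (b + e)) ?leq_addr ?leq_add2l //=.
have e0 : 0 <= e%:R :> R by [].
have de0 : 0 <= d%:R - e%:R :> R by rewrite subr_ge0 ler_nat.
have := ler_wpM2l e0 tail; have := ler_wpM2l de0 head.
lra.
Qed.

(* [q] at least the logarithm of the number of terms makes the maximum and the
   [l_q]-norm agree up to a factor 2. *)
Lemma le_of_power_sum (T : eqType) (s : seq T) (q : nat) (l V : R)
    (a : T -> R) :
  (0 < q)%N -> ((size s).*2 <= 2 ^ q)%N -> 1 <= l -> 0 <= V ->
  (forall x, 0 <= a x) ->
  \sum_(x <- s) a x ^+ q <= l * \sum_(x <- s) ((a x + V) ^+ q - a x ^+ q) ->
  {in s, forall x, a x <= 8 * l * q%:R * V}.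
Proof.
move=> q0 sq l1 V0 a0 sum_le x xs; set S := \sum_(x <- s) a x ^+ q in sum_le.
pose v := 4 * l * q%:R * V.
have v0 : 0 <= v by rewrite !mulr_ge0 //; lra.
have S_le : S <= 2 * (size s)%:R * v ^+ q.
  suff : S <= S / 2 + (size s)%:R * v ^+ q by lra.
  apply: (le_trans sum_le); rewrite mulr_sumr.
  apply: (@le_trans _ _ (\sum_(x <- s) (a x ^+ q / 2 + v ^+ q))).
    by apply: ler_sum => y _; exact: scaled_increment_le.
  rewrite big_split /= -mulr_suml big_const_seq count_predT iter_addr_0.
  by rewrite mulr_natl.
have -> : 8 * l * q%:R * V = 2 * v by rewrite /v; ring.
rewrite -(ler_pXn2r q0) ?nnegrE ?a0 ?(mulr_ge0 (ler0n R 2) v0) // exprMn.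
apply: (@le_trans _ _ S).
  rewrite /S (big_rem _ xs) /= lerDl; apply: sumr_ge0 => y _; exact: exprn_ge0.
apply: (le_trans S_le); apply: ler_wpM2r; first exact: exprn_ge0.
by rewrite -natrM -natrX ler_nat mul2n.
Qed.

End RealInequalities.

Lemma ler_sum_subpred (R : numDomainType) (I : Type) (r : seq I) (P Q : pred I)
    (f : I -> R) : (forall k, 0 <= f k) -> (forall k, P k -> Q k) ->
  \sum_(k <- r | P k) f k <= \sum_(k <- r | Q k) f k.
Proof.
move=> f0 PQ; rewrite [leLHS]big_mkcond [leRHS]big_mkcond /=.
by apply: ler_sum => k _; have := PQ k; case: (P k) => [->//|_]; case: ifP.
Qed.

Lemma ler_sum_cover (R : numDomainType) (T X : finType) (P : pred T)
    (S : X -> pred T) (f : T -> R) : (forall k, 0 <= f k) ->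
  (forall k, P k -> exists x, S x k) ->
  \sum_(k | P k) f k <= \sum_x \sum_(k | S x k) f k.
Proof.
move=> f0 cover; rewrite (exchange_big_dep predT) //= big_mkcond.
apply: ler_sum => k _; case: ifP => [/cover[x Sxk]|_]; last exact: sumr_ge0.
by rewrite (bigD1 x) //= lerDl; apply: sumr_ge0.
Qed.

(** * Binary logarithms *)

Section BinaryLogarithm.
Variable R : realType.
Implicit Type x y : R.

Lemma exists_exp2_ge x : exists k, x <= 2 ^+ k.
Proof. by exists (Num.bound x); exact/ltW/upper_nthrootP. Qed.

Definition ceil_log2 x : nat := ex_minn (exists_exp2_ge x).

Lemma ceil_log2_leq x k : (ceil_log2 x <= k)%N = (x <= 2 ^+ k).
Proof.
rewrite /ceil_log2; case: ex_minnP => c xc cmin; apply/idP/idP => [ck|/cmin//].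
by apply: (le_trans xc); rewrite ler_weXn2l // ler1n.
Qed.

Lemma le_exp_ceil_log2 x : x <= 2 ^+ ceil_log2 x.
Proof. by rewrite -ceil_log2_leq. Qed.

Lemma leq_ceil_log2 x y : x <= y -> (ceil_log2 x <= ceil_log2 y)%N.
Proof.
by move=> xy; rewrite ceil_log2_leq (le_trans xy) // le_exp_ceil_log2.
Qed.

Lemma exp_ceil_log2_lt x : (0 < ceil_log2 x)%N -> 2 ^+ ceil_log2 x < 2 * x.
Proof.
case cE : (ceil_log2 x) => [//|c] _; rewrite exprS ltr_pM2l // ltNge.
by rewrite -ceil_log2_leq cE ltnn.
Qed.

Lemma exp_ceil_log2_le x : 1 <= x -> 2 ^+ ceil_log2 x <= 2 * x.
Proof.
move=> x1; have [c0|/exp_ceil_log2_lt/ltW//] := posnP (ceil_log2 x).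
by rewrite c0 expr0; lra.
Qed.

Lemma ln2_ge : 1 / 2 <= ln 2 :> R.
Proof.
have : ln (1 + - (1 / 2) : R) <= - (1 / 2) by apply: le_ln1Dx; lra.
have -> : 1 + - (1 / 2) = 2^-1 :> R by field.
by rewrite lnV ?posrE //; lra.
Qed.

Lemma exp2_le_ln (k : nat) y : 2 ^+ k <= y -> k%:R <= 2 * ln y.
Proof.
move=> ky; have y0 : 0 < y by apply: lt_le_trans ky; rewrite exprn_gt0.
have : k%:R * ln 2 <= ln y.
  by rewrite mulr_natl -lnXn // ler_ln // posrE exprn_gt0.
by have := ler_wpM2l (ler0n R k) ln2_ge; lra.
Qed.

Lemma sum_exp2_le (k : nat) : \sum_(i < k.+1) 2 ^+ i <= 2 * 2 ^+ k :> R.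
Proof.
have := @subrX1 R 2 k.+1; rewrite (_ : 2 - 1 = 1) ?mul1r; last by ring.
by move=> <-; rewrite exprS; lra.
Qed.

End BinaryLogarithm.

(** * The p-norm of nonnegative vectors *)

Definition nonneg (R : realType) (m : nat) (x : 'I_m -> R) : Prop :=
  forall i, 0 <= x i.

Definition pnorm (R : realType) (m : nat) (p : R) (x : 'I_m -> R) : R :=
  (\sum_(i < m) x i `^ p) `^ p^-1.

Section PNorm.
Variables (R : realType) (m : nat) (p : R).
Hypothesis p_ge1 : 1 <= p.
Implicit Types (x y : 'I_m -> R) (M : R).

Local Notation pnorm := (@pnorm R m p).

Let p_gt0 : 0 < p := lt_le_trans ltr01 p_ge1.

Let p_neq0 : p != 0. Proof. by rewrite gt_eqF. Qed.

Lemma pnorm_ge0 x : 0 <= pnorm x.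
Proof. exact: powR_ge0. Qed.

Lemma pnorm0 : pnorm (fun=> 0) = 0.
Proof. by rewrite /pnorm big1 ?powR0 ?invr_eq0 // => i _; rewrite powR0. Qed.

Lemma pnorm_leP x M : 0 <= M ->
  pnorm x <= M <-> \sum_(i < m) x i `^ p <= M `^ p.
Proof.
move=> M0; have sum_ge0 : 0 <= \sum_(i < m) x i `^ p.
  by apply: sumr_ge0 => i _; exact: powR_ge0.
split=> [/(ler_powR_base (ltW p_gt0) (pnorm_ge0 x))|le_sum].
  by rewrite /pnorm -powRrM mulVf // powRr1.
rewrite -[M]powRr1 // -(mulfV p_neq0) powRrM.
by apply: ler_powR_base; rewrite // invr_ge0 ltW.
Qed.

Lemma le_pnorm x y : nonneg x -> (forall i, x i <= y i) -> pnorm x <= pnorm y.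
Proof.
move=> x0 xy; apply/pnorm_leP; first exact: pnorm_ge0.
rewrite /pnorm -powRrM mulVf // powRr1; last first.
  by apply: sumr_ge0 => i _; exact: powR_ge0.
by apply: ler_sum => i _; rewrite ler_powR_base // ltW.
Qed.

Let extend x (k : nat) : R := oapp x 0 (insub k : option 'I_m).

Let Lnorm_extend x : nonneg x ->
  Lnorm counting p%:E (EFin \o extend x) = (pnorm x)%:E.
Proof.
move=> x0; rewrite Lnorm_counting // (nneseries_split 0 m); last first.
  by move=> k _; exact: poweR_ge0.
rewrite add0n [X in (_ + X)%E]eseries0 ?adde0; last first.
  move=> k mk _; rewrite /extend /= insubF ?ltnNge ?mk //=.
  by rewrite normr0 powR0.
rewrite big_mkord /pnorm -poweR_EFin -sumEFin; congr (_ `^ _)%E.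
by apply: eq_bigr => i _; rewrite /extend /= valK /= ger0_norm.
Qed.

Lemma ler_pnormD x y : nonneg x -> nonneg y ->
  pnorm (fun i => x i + y i) <= pnorm x + pnorm y.
Proof.
move=> x0 y0; have xy0 : nonneg (fun i => x i + y i).
  by move=> i; rewrite addr_ge0.
have extendD : extend (fun i => x i + y i) = (extend x \+ extend y)%R.
  by apply/funext => k; rewrite /extend /=; case: insub => //=; rewrite addr0.
have := minkowski_EFin counting (f := extend x) (g := extend y) _ _ p_ge1.
rewrite -extendD (Lnorm_extend x0) (Lnorm_extend y0) (Lnorm_extend xy0).
by rewrite -EFinD lee_fin; apply.
Qed.

Lemma ler_pnorm_sum (I : Type) (s : seq I) (x : I -> 'I_m -> R) :
  (forall j, nonneg (x j)) ->
  pnorm (fun i => \sum_(j <- s) x j i) <= \sum_(j <- s) pnorm (x j).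
Proof.
move=> x0; elim: s => [|j s IH].
  by under [X in pnorm X]funext do rewrite big_nil; rewrite pnorm0 big_nil.
under [X in pnorm X]funext do rewrite big_cons.
rewrite big_cons; apply: (le_trans (ler_pnormD _ _)); rewrite ?lerD2l //.
by move=> i; apply: sumr_ge0 => k _; exact: x0.
Qed.

End PNorm.

(** * Functions with increasing differences *)

Definition add_at (R : realType) (m : nat) (x : 'I_m -> R) (i : 'I_m) (d : R) :
    'I_m -> R :=
  fun k => x k + d *+ (k == i).

Section IncreasingDifferences.
Variables (R : realType) (m : nat).
Implicit Types (F : ('I_m -> R) -> R) (x y : 'I_m -> R) (i : 'I_m) (d : R).

Definition coordwise_monotone F := forall x y, nonneg x ->
  (forall k, x k <= y k) -> F x <= F y.

Definition increment F x i d : R := F (add_at x i d) - F x.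

Definition increasing_differences F := forall x y i d, nonneg x ->
  (forall k, x k <= y k) -> 0 <= d -> increment F x i d <= increment F y i d.

Lemma increment_ge0 F x i d : coordwise_monotone F -> nonneg x -> 0 <= d ->
  0 <= increment F x i d.
Proof.
move=> F_mono x0 d0; rewrite subr_ge0 F_mono // => k.
by rewrite lerDl mulrn_wge0.
Qed.

Lemma sum_increments_le F (T : Type) (r : seq T) (A : pred T) (o : T -> 'I_m)
    (w : T -> 'I_m -> R) x :
  increasing_differences F -> nonneg x -> (forall k i, 0 <= w k i) ->
  \sum_(k <- r | A k) increment F x (o k) (w k (o k)) <=
  F (fun i => x i + \sum_(k <- r | A k && (o k == i)) w k i) - F x.
Proof.
move=> F_incr x0 w0; elim: r => [|k r IH].
  under [X in F X - _]funext do rewrite big_nil addr0.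
  by rewrite big_nil subrr.
under [X in F X - _]funext do rewrite big_cons.
rewrite big_cons; case: (A k) => //=.
pose y i := x i + \sum_(k <- r | A k && (o k == i)) w k i.
have xy i : x i <= y i by rewrite lerDl sumr_ge0.
rewrite [X in F X - _](_ : _ = add_at y (o k) (w k (o k))); last first.
  apply/funext => i; rewrite /add_at /y eq_sym.
  by case: eqP => [->|_]; rewrite ?mulr1n ?mulr0n ?addr0 // addrCA addrC.
have := F_incr x y (o k) (w k (o k)) x0 xy (w0 _ _).
by rewrite /increment -/y in IH *; lra.
Qed.

End IncreasingDifferences.

Section Potential.
Variables (R : realType) (m : nat) (p : R) (q : nat).
Hypotheses (p_ge1 : 1 <= p) (p_le_q : p <= q%:R).
Implicit Types x y : 'I_m -> R.

Definition potential x : R := pnorm p x ^+ q.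

Let p_gt0 : 0 < p := lt_le_trans ltr01 p_ge1.

Lemma potentialE x : potential x = (\sum_(i < m) x i `^ p) `^ (q%:R / p).
Proof.
by rewrite /potential -powR_mulrn ?pnorm_ge0 // /pnorm -powRrM [p^-1 * _]mulrC.
Qed.

Lemma potential0 : potential (fun=> 0) = 0.
Proof.
have q0 : (0 < q)%N by rewrite -(ltr0n R) (lt_le_trans p_gt0).
by rewrite /potential pnorm0 // expr0n gtn_eqF.
Qed.

Lemma potential_monotone : coordwise_monotone potential.
Proof.
by move=> x y x0 xy; rewrite lerXn2r ?nnegrE ?pnorm_ge0 ?le_pnorm.
Qed.

Let psum_add_at x i d : \sum_(k < m) add_at x i d k `^ p =
  \sum_(k < m) x k `^ p + ((x i + d) `^ p - x i `^ p).
Proof.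
rewrite (bigD1 i) //= [in RHS](bigD1 i) //= {1}/add_at eqxx mulr1n.
rewrite (eq_bigr (fun k => x k `^ p)); first by ring.
by move=> k /negPf ki; rewrite /add_at ki addr0.
Qed.

(* Both [t `^ p] and [t `^ (q / p)] are convex. *)
Lemma potential_increasing_differences : increasing_differences potential.
Proof.
move=> x y i d x0 xy d0; have p0 := ltW p_gt0.
rewrite /increment !potentialE !psum_add_at; apply: powR_increment_le.
- by rewrite ler_pdivlMr // mul1r.
- by apply: sumr_ge0 => k _; exact: powR_ge0.
- by apply: ler_sum => k _; exact: ler_powR_base.
- by rewrite subr_ge0 ler_powR_base // lerDl.
- exact: powR_increment_le.
Qed.

End Potential.

(** * Loads of assignments *)

Section AssignedLoad.
Variables (R : realType) (m : nat) (T : finType) (w : T -> 'I_m -> R).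
Hypothesis w_ge0 : forall k i, 0 <= w k i.
Implicit Types (A B : pred T) (f : T -> 'I_m) (i : 'I_m).

Definition assigned_load A f : 'I_m -> R :=
  fun i => \sum_(k | A k && (f k == i)) w k i.

Lemma assigned_load_ge0 A f : nonneg (assigned_load A f).
Proof. by move=> i; exact: sumr_ge0. Qed.

Lemma assigned_load_pred0 A f : A =1 pred0 -> assigned_load A f = fun=> 0.
Proof. by move=> A0; apply/funext => i; apply: big_pred0 => k; rewrite A0. Qed.

Lemma eq_assigned_load A B f : A =1 B -> assigned_load A f = assigned_load B f.
Proof. by move=> AB; apply/funext => i; apply: eq_bigl => k; rewrite AB. Qed.

Lemma le_assigned_load A B f i : (forall k, A k -> B k) ->
  assigned_load A f i <= assigned_load B f i.
Proof.
by move=> AB; apply: ler_sum_subpred => // k /andP[/AB -> ->].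
Qed.

Lemma assigned_loadU1 A f j : ~~ A j ->
  assigned_load (fun k => (k == j) || A k) f =
  add_at (assigned_load A f) (f j) (w j (f j)).
Proof.
move=> nAj; apply/funext => i; rewrite /add_at /assigned_load eq_sym.
have restE : \sum_(k | ((k == j) || A k) && (f k == i) && (k != j)) w k i =
    \sum_(k | A k && (f k == i)) w k i.
  apply: eq_bigl => k; case: (eqVneq k j) => [->|_] /=; last by rewrite andbT.
  by rewrite andbF (negPf nAj).
have [fj|fj] := eqVneq (f j) i.
  by rewrite (bigD1 j) ?eqxx ?fj //= restE addrC.
rewrite addr0; apply: eq_bigl => k; case: (eqVneq k j) => [->|//].
by rewrite (negPf fj) !andbF.
Qed.

End AssignedLoad.

Definition in_slots (b e t : nat) : bool := (b < t <= b + e)%N.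

Lemma sum_in_slots (R : realType) (f : nat -> R) (lo hi b e : nat) :
  (lo <= b)%N -> (b + e <= hi)%N ->
  \sum_(lo.+1 <= t < hi.+1 | in_slots b e t) f t =
  \sum_(b.+1 <= t < b.+1 + e) f t.
Proof.
move=> lob behi; rewrite (@big_nat_widen _ _ _ b.+1 _ hi.+1); last by lia.
rewrite (@big_nat_widenl _ _ _ b.+1 lo.+1) //.
by apply: eq_bigl => t; rewrite /in_slots /= andbC; lia.
Qed.

(** * Greedy assignment *)

Definition insertion_cost (R : realType) (m : nat) (F : ('I_m -> R) -> R)
    (load : nat -> 'I_m -> R) (b e : nat) (i : 'I_m) (d : R) : R :=
  \sum_(b.+1 <= t < b.+1 + e) increment F (load t) i d.

Section Greedy.
Variables (R : realType) (m n : nat) (F : ('I_m -> R) -> R).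
Variables (arr len dur : 'I_n -> nat) (w : 'I_n -> 'I_m -> R) (G : pred 'I_n).
Variables (a o : 'I_n -> 'I_m) (lo hi : nat) (l : R).

Definition planned_load (j t : nat) : 'I_m -> R :=
  assigned_load w (fun k => [&& (k < j)%N, G k & in_slots (arr k) (len k) t]) a.

Definition reference_load (t : nat) : 'I_m -> R :=
  assigned_load w (fun k => G k && in_slots (arr k) (dur k) t) o.

Hypothesis F_mono : coordwise_monotone F.
Hypothesis F_incr : increasing_differences F.
Hypothesis w_ge0 : forall k i, 0 <= w k i.
Hypothesis arr_mono : forall k j : 'I_n, (k <= j)%N -> (arr k <= arr j)%N.
Hypothesis window : forall j, G j -> (lo <= arr j)%N /\ (arr j + len j <= hi)%N.
Hypothesis dur_bounds : forall j, G j -> (0 < dur j <= len j)%N.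
Hypothesis l_ge0 : 0 <= l.
Hypothesis len_le : forall j, G j -> (len j)%:R <= l * (dur j)%:R.
Hypothesis greedy : forall j, G j ->
  insertion_cost F (planned_load j) (arr j) (len j) (a j) (w j (a j)) <=
  insertion_cost F (planned_load j) (arr j) (len j) (o j) (w j (o j)).

Lemma planned_load_ge0 j t : nonneg (planned_load j t).
Proof. exact: assigned_load_ge0. Qed.

(* No job presented before [j] starts after the arrival of [j]. *)
Lemma planned_load_nonincreasing (j : 'I_n) t t' i : (arr j < t <= t')%N ->
  planned_load j t' i <= planned_load j t i.
Proof.
move=> /andP[jt tt']; apply: le_assigned_load => // k.
move=> /and3P[kj -> /andP[_ t'k]].
rewrite kj /in_slots (leq_trans tt' t'k) andbT.
exact: leq_ltn_trans (arr_mono (ltnW kj)) jt.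
Qed.

Lemma planned_load_le j t i : planned_load j t i <= planned_load n t i.
Proof.
by apply: le_assigned_load => // k /and3P[_ -> ->]; rewrite ltn_ord.
Qed.

Lemma planned_loadS (j : 'I_n) t : planned_load j.+1 t =
  if G j && in_slots (arr j) (len j) t
  then add_at (planned_load j t) (a j) (w j (a j)) else planned_load j t.
Proof.
have ltnS_eq (k : 'I_n) : (k < j.+1)%N = (k == j) || (k < j)%N.
  by rewrite ltnS leq_eqVlt.
case: ifP => Gj; last first.
  apply: eq_assigned_load => k; rewrite ltnS_eq; case: eqP => [->|//].
  by rewrite Gj !andbF.
rewrite -assigned_loadU1 ?ltnn //; apply: eq_assigned_load => k.
by rewrite ltnS_eq; case: eqP => [->|//]; rewrite Gj.
Qed.

Let potential_before j := \sum_(lo.+1 <= t < hi.+1) F (planned_load j t).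

Let potential_beforeS (j : 'I_n) :
  potential_before j.+1 - potential_before j = if G j then
    insertion_cost F (planned_load j) (arr j) (len j) (a j) (w j (a j)) else 0.
Proof.
rewrite /potential_before -sumrB; case: ifP => Gj; last first.
  by rewrite big1 // => t _; rewrite planned_loadS Gj subrr.
have [loj jhi] := window Gj.
rewrite /insertion_cost -(sum_in_slots _ loj jhi) [RHS]big_mkcond.
apply: eq_bigr => t _; rewrite planned_loadS Gj /=.
by case: ifP => // _; rewrite subrr.
Qed.

Lemma insertion_cost_le (j : 'I_n) : G j ->
  insertion_cost F (planned_load j) (arr j) (len j) (a j) (w j (a j)) <=
  l * \sum_(lo.+1 <= t < hi.+1 | in_slots (arr j) (dur j) t)
        increment F (planned_load n t) (o j) (w j (o j)).
Proof.
move=> Gj; have [loj jhi] := window Gj.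
have /andP[dur0 dur_len] := dur_bounds Gj.
have durR0 : 0 < (dur j)%:R :> R by rewrite ltr0n.
rewrite sum_in_slots //; last by apply: leq_trans jhi; rewrite leq_add2l.
apply: (le_trans (greedy Gj)).
pose g t := increment F (planned_load j t) (o j) (w j (o j)).
have g_sum_ge0 : 0 <= \sum_((arr j).+1 <= t < (arr j).+1 + dur j) g t.
  apply: sumr_ge0 => t _; apply: increment_ge0 => //.
  exact: planned_load_ge0.
apply: (@le_trans _ _ (l * \sum_((arr j).+1 <= t < (arr j).+1 + dur j) g t)).
  rewrite -(ler_pM2l durR0); apply: (@le_trans _ _ ((len j)%:R *
    \sum_((arr j).+1 <= t < (arr j).+1 + dur j) g t)).
    apply: nonincreasing_sum_average => // s t st.
    apply: F_incr => // [|k]; first exact: planned_load_ge0.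
    by apply: planned_load_nonincreasing; lia.
  by rewrite mulrA [_ * l]mulrC ler_wpM2r // len_le.
apply: ler_wpM2l => //; apply: ler_sum => t _; apply: F_incr => // [|k].
  exact: planned_load_ge0.
exact: planned_load_le.
Qed.

Lemma greedy_potential_le :
  \sum_(lo.+1 <= t < hi.+1) (F (planned_load n t) - F (fun=> 0)) <=
  l * \sum_(lo.+1 <= t < hi.+1)
        (F (fun i => planned_load n t i + reference_load t i) -
         F (planned_load n t)).
Proof.
have start : \sum_(lo.+1 <= t < hi.+1) F (fun=> 0) = potential_before 0.
  by apply: eq_bigr => t _; rewrite /planned_load assigned_load_pred0.
rewrite sumrB start -/(potential_before n) -(telescope_sumr _ (leq0n n)).
rewrite big_mkord.
under eq_bigr do rewrite potential_beforeS.
rewrite -big_mkcond /=.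
apply: (le_trans (ler_sum _ insertion_cost_le)).
rewrite -mulr_sumr; apply: ler_wpM2l => //.
rewrite (exchange_big_dep predT) //=; apply: ler_sum => t _.
by apply: sum_increments_le => //; exact: planned_load_ge0.
Qed.

End Greedy.

Lemma greedy_pnorm_le (R : realType) (m n : nat) (p : R) (q : nat)
    (arr len dur : 'I_n -> nat) (w : 'I_n -> 'I_m -> R) (G : pred 'I_n)
    (a o : 'I_n -> 'I_m) (lo hi : nat) (l V : R) :
  1 <= p -> p <= q%:R -> ((hi - lo).*2 <= 2 ^ q)%N ->
  (forall k i, 0 <= w k i) ->
  (forall k j : 'I_n, (k <= j)%N -> (arr k <= arr j)%N) ->
  (forall j, G j -> (lo <= arr j)%N /\ (arr j + len j <= hi)%N) ->
  (forall j, G j -> (0 < dur j <= len j)%N) ->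
  1 <= l ->
  (forall j, G j -> (len j)%:R <= l * (dur j)%:R) ->
  (forall j, G j -> let load := planned_load arr len w G a j in
    insertion_cost (potential p q) load (arr j) (len j) (a j) (w j (a j)) <=
    insertion_cost (potential p q) load (arr j) (len j) (o j) (w j (o j))) ->
  (forall t, pnorm p (reference_load arr dur w G o t) <= V) ->
  forall t, pnorm p (planned_load arr len w G a n t) <= 8 * l * q%:R * V.
Proof.
move=> p1 pq hiq w0 arr_mono window dur_bounds l1 len_le greedy refV t.
set load := planned_load _ _ _ _ _ n in greedy *.
have V0 : 0 <= V by apply: le_trans (refV 0); exact: pnorm_ge0.
have q0 : (0 < q)%N by rewrite -(ltr0n R); lra.
have l0 : 0 <= l by lra.
have [tlohi|tout] := boolP (t \in index_iota lo.+1 hi.+1); last first.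
  rewrite /load /planned_load assigned_load_pred0 ?pnorm0 ?mulr_ge0 // => k.
  apply/negP => /and3P[_ /window[? ?] /andP[? ?]].
  by move/negP: tout; apply; rewrite mem_index_iota; lia.
apply: (@le_of_power_sum R _ _ q l V (fun t => pnorm p (load t))) tlohi => //.
- by rewrite size_iota subSS.
- by move=> s; exact: pnorm_ge0.
have := greedy_potential_le (potential_monotone q p1)
  (potential_increasing_differences p1 pq) w0 arr_mono window dur_bounds l0
  len_le greedy.
rewrite potential0 //; under eq_bigr do rewrite subr0.
move/le_trans; apply; apply: ler_wpM2l => //; apply: ler_sum => s _.
rewrite lerD2r lerXn2r ?nnegrE ?addr_ge0 ?pnorm_ge0 //.
by rewrite (le_trans (ler_pnormD p1 _ _)) ?lerD2l //; exact: assigned_load_ge0.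
Qed.

(** * Size classes of durations *)

Section SizeClasses.
Variables (R : realType) (p : R).

Definition base_exponent : nat := (Num.truncn p).+1.

Definition size_class (k : nat) : nat :=
  ceil_log2 (k%:R / base_exponent%:R : R).

Definition class_log_length (c : nat) : nat := base_exponent * 2 ^ c.

Definition class_length (c : nat) : nat := 2 ^ class_log_length c.

(* [2 ^ class_exponent c] is twice the number of slots in two blocks of the
   class [c]. *)
Definition class_exponent (c : nat) : nat := (class_log_length c).+2.

Lemma base_exponent_ge : p <= base_exponent%:R.
Proof. exact/ltW/truncnS_gt. Qed.

Lemma base_exponent_le : 1 <= p -> base_exponent%:R <= 2 * p.
Proof.
move=> p1; have p0 : 0 <= p by lra.
by have /andP[+ _] := truncn_itv p0; rewrite /base_exponent -natr1; lra.
Qed.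

Lemma size_class_leq k c : (size_class k <= c)%N = (k <= class_log_length c)%N.
Proof.
by rewrite ceil_log2_leq ler_pdivrMr // mulrC -natrX -natrM ler_nat.
Qed.

Lemma class_log_length_size_class_le k :
  (class_log_length (size_class k) <= base_exponent + 2 * k)%N.
Proof.
have [c0|cpos] := posnP (size_class k).
  by rewrite /class_log_length c0 muln1 leq_addr.
have := exp_ceil_log2_lt cpos; rewrite -/(size_class k) mulrA ltr_pdivlMr //.
rewrite -natrX -!natrM ltr_nat mulnC => lt_k.
by rewrite /class_log_length; lia.
Qed.

Lemma sum_class_exponent_le (c : nat) :
  \sum_(d < c.+1) (class_exponent d)%:R <= 6 * (class_log_length c)%:R :> R.
Proof.
apply: (@le_trans _ _ (\sum_(d < c.+1) 3 * base_exponent%:R * 2 ^+ d)).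
  apply: ler_sum => d _; rewrite -natrX -!natrM ler_nat -mulnA.
  have : (0 < class_log_length d)%N by rewrite muln_gt0 expn_gt0.
  by rewrite /class_exponent -/(class_log_length d); lia.
have := ler_wpM2l (ler0n R (3 * base_exponent)) (sum_exp2_le R c).
by rewrite -mulr_sumr /class_log_length !natrM natrX; lra.
Qed.

Lemma class_log_length_le_ln (k : nat) (y : R) : 1 <= p -> 1 <= y ->
  2 ^+ k <= 4 * y -> (class_log_length (size_class k))%:R <= 10 * (p + ln y).
Proof.
move=> p1 y1 /exp2_le_ln.
have y0 : 0 < y by lra.
have lny := ln_ge0 y1.
have ln4 : ln 4 <= 2 :> R.
  have ln2 : ln (1 + 1 : R) <= 1 by apply: le_ln1Dx; lra.
  by rewrite (_ : 4 = (1 + 1) ^+ 2) ?lnXn ?mulr2n //; [lra|ring].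
rewrite lnM ?posrE // => k_le.
have := class_log_length_size_class_le k; rewrite -(ler_nat R) natrD natrM.
have := base_exponent_le p1.
lra.
Qed.

(* [384 = 8 * 2 * 2 * 2 * 6] stands for the loss of the greedy rule, the
   rounding of the estimates, the two blocks, and the geometric sums over
   guesses and classes; [20 = 2 * 10] for the rounding of [mu1] and of the
   largest class. *)
Definition balance_ratio (mu D : R) : R := 384 * 20 * (mu * (p + ln (mu * D))).

Lemma balance_ratio_ge (mu1 mu2 D : R) :
  1 <= p -> 1 <= mu1 -> 1 <= mu2 -> 1 <= D ->
  384 * mu2 * 2 ^+ ceil_log2 mu1 *
    (class_log_length (size_class (ceil_log2 mu1 + ceil_log2 D)))%:R <=
  balance_ratio (mu1 * mu2) D.
Proof.
move=> p1 mu1_ge1 mu2_ge1 D1; set c := (class_log_length _)%:R.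
have exp_le x : 1 <= x -> 2 ^+ ceil_log2 x <= 2 * x := @exp_ceil_log2_le R x.
have c_le : c <= 10 * (p + ln (mu1 * mu2 * D)).
  apply: class_log_length_le_ln; rewrite ?mulr_ege1 //.
  have : 2 ^+ ceil_log2 mu1 * 2 ^+ ceil_log2 D <= 2 * mu1 * (2 * D).
    by apply: ler_pM; rewrite ?exprn_ge0 ?exp_le.
  have : 0 <= (mu2 - 1) * (mu1 * D) by rewrite !mulr_ge0 //; lra.
  by rewrite exprD; lra.
have : mu2 * (2 ^+ ceil_log2 mu1 * c) <=
    mu2 * (2 * mu1 * (10 * (p + ln (mu1 * mu2 * D)))).
  apply: ler_wpM2l; first by lra.
  by apply: ler_pM; rewrite ?exprn_ge0 ?exp_le.
rewrite /balance_ratio; lra.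
Qed.

Lemma balance_ratio_gt0 (mu D : R) : 1 <= p -> 1 <= mu -> 1 <= D ->
  0 < balance_ratio mu D.
Proof.
move=> p1 mu_ge1 D_ge1.
have ln_muD : 0 <= ln (mu * D) by rewrite ln_ge0 // mulr_ege1.
by rewrite !mulr_gt0 ?ltr0n ?(lt_le_trans ltr01) ?ler_wpDr.
Qed.

End SizeClasses.

Lemma balance_ratio_ln_le (R : realType) (m : nat) (mu D : R) : (0 < m)%N ->
  1 <= mu -> 1 <= D -> balance_ratio (Num.max 1 (ln m%:R)) mu D <=
  384 * 20 * 2 * (mu * Num.max 1 (ln (m%:R * mu * D))).
Proof.
move=> m0 mu_ge1 D_ge1; have muD1 : 1 <= mu * D by rewrite mulr_ege1.
have m1 : 1 <= m%:R :> R by rewrite ler1n.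
have ln_m := ln_ge0 m1; have ln_muD := ln_ge0 muD1.
have -> : ln (m%:R * mu * D) = ln m%:R + ln (mu * D).
  by rewrite -mulrA lnM // posrE; lra.
set M := Num.max 1 (_ + _).
have M1 : 1 <= M by rewrite le_max lexx.
have ln_le : ln m%:R + ln (mu * D) <= M by rewrite le_max lexx orbT.
have max_le : Num.max 1 (ln m%:R) + ln (mu * D) <= 2 * M.
  by case: (leP 1 (ln m%:R)) => _; lra.
have mu0 : 0 <= mu by lra.
by rewrite /balance_ratio; have := ler_wpM2l mu0 max_le; lra.
Qed.

(** * The algorithm *)

(* What the algorithm assumes about a job: its duration is [2 ^ log_length], and
   durations exceed their estimates by a factor of at most [2 ^ guess]. *)
Record task (R : realType) (m : nat) := Task {
  release : nat;
  guess : nat;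
  log_length : nat;
  task_load : 'I_m -> \bar R
}.

Definition group_key : Type := nat * nat * nat.

Definition key_guess (key : group_key) : nat := key.1.1.

Definition key_class (key : group_key) : nat := key.1.2.

Definition key_block (key : group_key) : nat := key.2.

Section Algorithm.
Variables (R : realType) (m : nat) (i0 : 'I_m) (p : R).
Implicit Types (x y : task R m) (i : 'I_m) (h : seq (task R m * 'I_m)).

Definition task_class x : nat := size_class p (log_length x).

Definition task_length x : nat := 2 ^ log_length x.

Definition task_weight x i : R := fine (task_load x i).

Definition finite_on x i : bool := (task_load x i < +oo)%E.

Definition task_group x : group_key :=
  (guess x, task_class x, release x %/ class_length p (task_class x))%N.

Definition group_load h x (t : nat) : 'I_m -> R := fun i =>
  \sum_(y <- h | [&& task_group y.1 == task_group x,
      in_slots (release y.1) (task_length y.1) t & y.2 == i]) task_weight y.1 i.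

Definition placement_cost h x i : R :=
  insertion_cost (potential p (class_exponent p (task_class x)))
    (group_load h x) (release x) (task_length x) i (task_weight x i).

Definition place h x : 'I_m :=
  if [pick i | finite_on x i] is Some i1
  then [arg min_(i < i1 | finite_on x i) placement_cost h x i]%O
  else i0.

Lemma place_finite h x i : finite_on x i -> finite_on x (place h x).
Proof.
rewrite /place; move: (placement_cost h x) => cost xi.
case: pickP => [i1 xi1|/(_ i)]; last by rewrite xi.
by case: (arg_minP cost xi1).
Qed.

Lemma place_cost_le h x i : finite_on x i ->
  placement_cost h x (place h x) <= placement_cost h x i.
Proof.
rewrite /place; move: (placement_cost h x) => cost xi.
case: pickP => [i1 xi1|/(_ i)]; last by rewrite xi.
by case: (arg_minP cost xi1) => i2 _; exact.
Qed.

(* A job that has not departed at time [t] is alive in slot [t.+1]. *)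
Definition elapsed (J : observation R m) (t : nat) : nat :=
  let e := (t.+1 - obs_arrival J)%N in
  if obs_duration J is Some d then minn d e else e.

Definition plan (s : seq (observation R m)) (J : observation R m) : task R m :=
  let g := \max_(K <- s)
    ceil_log2 ((elapsed K (obs_arrival J))%:R / obs_estimate K) in
  Task (obs_arrival J) g (g + ceil_log2 (obs_estimate J)) (obs_load J).

(* Both the observations and the resulting placements are listed with the latest
   one first. *)
Fixpoint placements (s : seq (observation R m)) : seq (task R m * 'I_m) :=
  if s is J :: s' then
    let h := placements s' in let x := plan s J in (x, place h x) :: h
  else [::].

Definition balance : online_algorithm R m := fun s =>
  if placements (rev s) is (_, i) :: _ then i else i0.

Lemma task_length_le x : (task_length x <= class_length p (task_class x))%N.
Proof. by rewrite leq_exp2l // -size_class_leq. Qed.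

End Algorithm.

Lemma elapsed_observe (R : realType) (m now t : nat) (J : job R m) :
  (t <= now)%N ->
  elapsed (observe now J) t = minn (duration J) (t.+1 - arrival J).
Proof. by rewrite /elapsed /observe /=; case: ifP => //=; lia. Qed.

Section RunOfBalance.
Variables (R : realType) (m : nat) (i0 : 'I_m) (p : R) (I : instance R m).
Hypothesis arrival_mono : forall j k : 'I_(njobs I), (j <= k)%N ->
  (arrival (jobs I j) <= arrival (jobs I k))%N.

Local Notation n := (njobs I).
Local Notation assignment := (run (balance i0 p) (I := I)).

Definition job_guess (j : 'I_n) : nat :=
  \max_(k < n | (k <= j)%N)
    let e := minn (duration (jobs I k))
      ((arrival (jobs I j)).+1 - arrival (jobs I k)) in
    ceil_log2 (e%:R / estimate (jobs I k)).

Definition job_task (j : 'I_n) : task R m :=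
  Task (arrival (jobs I j)) (job_guess j)
    (job_guess j + ceil_log2 (estimate (jobs I j))) (load (jobs I j)).

Definition jobs_before (j : nat) : seq 'I_n :=
  [seq k : 'I_n <- enum 'I_n | (k < j)%N].

Definition observations_before (now j : nat) : seq (observation R m) :=
  rev [seq observe now (jobs I k) | k <- jobs_before j].

Lemma jobs_beforeS (j : 'I_n) : jobs_before j.+1 = rcons (jobs_before j) j.
Proof.
have val_before k : (k <= n)%N -> map val (jobs_before k) = iota 0 k.
  by move=> kn; rewrite -(filter_map val (fun k' => k' < k)%N) val_enum_ord
    (@filter_iota_ltn 0 n k).
apply: (inj_map val_inj).
rewrite map_rcons !val_before // ?(ltnW (ltn_ord j)) //.
by rewrite -addn1 iotaD cats1.
Qed.

Lemma plan_observe (now : nat) (j : 'I_n) : (arrival (jobs I j) <= now)%N ->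
  plan (observations_before now j.+1) (observe now (jobs I j)) = job_task j.
Proof.
move=> jnow; rewrite /plan /=.
suff -> : \max_(K <- observations_before now j.+1)
    ceil_log2 ((elapsed K (arrival (jobs I j)))%:R / obs_estimate K) =
  job_guess j by [].
rewrite bigop.big_rev big_map big_filter big_enum_cond /=.
by apply: eq_bigr => k _; rewrite elapsed_observe.
Qed.

Lemma placements_observeS (now : nat) (j : 'I_n) :
  (arrival (jobs I j) <= now)%N ->
  placements i0 p (observations_before now j.+1) =
  let h := placements i0 p (observations_before now j) in
  (job_task j, place i0 p h (job_task j)) :: h.
Proof.
move=> /plan_observe.
rewrite /observations_before jobs_beforeS map_rcons rev_rcons.
by move=> /= ->.
Qed.

Lemma run_balanceE (j : 'I_n) : assignment j =
  place i0 p (placements i0 p (observations_before (arrival (jobs I j)) j))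
    (job_task j).
Proof.
rewrite /run /balance -/(jobs_before j.+1) -/(observations_before _ j.+1).
by rewrite placements_observeS.
Qed.

Lemma placements_observe (now j : nat) : (j <= n)%N ->
  (forall k : 'I_n, (k < j)%N -> (arrival (jobs I k) <= now)%N) ->
  placements i0 p (observations_before now j) =
  [seq (job_task k, assignment k) | k <- rev (jobs_before j)].
Proof.
elim: j now => [|j IH] now jn arr_now.
  rewrite /observations_before /jobs_before.
  by rewrite (eq_filter (a2 := pred0)) ?filter_pred0.
pose j' := Ordinal jn.
rewrite (placements_observeS (arr_now j' (ltnSn j))).
rewrite (jobs_beforeS j') rev_rcons /=.
rewrite run_balanceE !IH ?(ltnW jn) // => k kj.
  by apply: arrival_mono; exact: ltnW.
exact/arr_now/ltnW.
Qed.

Definition job_weight (j : 'I_n) (i : 'I_m) : R := fine (load (jobs I j) i).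

Definition job_length (j : 'I_n) : nat := task_length (job_task j).

Definition job_group (j : 'I_n) : group_key := task_group p (job_task j).

Definition job_planned_load (key : group_key) (j t : nat) : 'I_m -> R :=
  planned_load (fun k => arrival (jobs I k)) job_length job_weight
    (fun k => job_group k == key) assignment j t.

Lemma group_load_placements (j : 'I_n) :
  group_load p (placements i0 p (observations_before (arrival (jobs I j)) j))
    (job_task j) = job_planned_load (job_group j) j.
Proof.
rewrite placements_observe ?(ltnW (ltn_ord j)) //; last first.
  by move=> k kj; exact: arrival_mono (ltnW kj).
apply/funext => t; apply/funext => i.
rewrite /group_load big_map bigop.big_rev big_filter_cond big_enum_cond.
by apply: eq_bigl => k; rewrite /= -!andbA.
Qed.

Lemma run_balance_finite (j : 'I_n) i : (load (jobs I j) i < +oo)%E ->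
  (load (jobs I j) (assignment j) < +oo)%E.
Proof.
by rewrite run_balanceE; exact: (@place_finite _ _ _ _ _ (job_task j)).
Qed.

Lemma run_balance_greedy (j : 'I_n) i : (load (jobs I j) i < +oo)%E ->
  let cost i := insertion_cost
    (potential p (class_exponent p (key_class (job_group j))))
    (job_planned_load (job_group j) j) (arrival (jobs I j)) (job_length j) i
    (job_weight j i) in
  cost (assignment j) <= cost i.
Proof.
move=> ji /=; have := @place_cost_le _ _ i0 p (placements i0 p
  (observations_before (arrival (jobs I j)) j)) (job_task j) i ji.
by rewrite -run_balanceE /placement_cost group_load_placements.
Qed.

End RunOfBalance.

(** * Analysis of the algorithm *)

Section DistortionBounds.
Variables (R : realType) (m : nat) (I : instance R m) (mu1 mu2 : R).
Hypothesis valid : valid_instance I.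
Hypothesis dist : distortion_bounds I mu1 mu2.

Local Notation n := (njobs I).
Local Notation arr k := (arrival (jobs I k)).
Local Notation dur k := (duration (jobs I k)).
Local Notation est k := (estimate (jobs I k)).

Lemma arrival_mono (j k : 'I_n) : (j <= k)%N -> (arr j <= arr k)%N.
Proof. by case: valid => _ + _ _ _; apply. Qed.

Lemma duration_gt0 (j : 'I_n) : (0 < dur j)%N.
Proof. by case: valid => _ _ /(_ j)/andP[]. Qed.

Lemma estimate_gt0 (j : 'I_n) : 0 < est j.
Proof. by case: valid => _ _ _ /(_ j)/(lt_le_trans ltr01). Qed.

Lemma job_weight_ge0 (j : 'I_n) i : 0 <= job_weight j i.
Proof. by case: valid => _ _ _ _ /(_ j i)/fine_ge0. Qed.

Lemma le_max_estimate (j : 'I_n) : est j <= max_estimate I.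
Proof. exact: (le_bigmax _ (fun j => est j)). Qed.

Lemma estimate_le_duration (j : 'I_n) : est j <= mu2 * (dur j)%:R.
Proof.
case: dist => _ mu2_ge1 /(_ j)/andP[+ _].
by rewrite ceil_le_int -pmulrn ler_pdivrMr 1?mulrC // (lt_le_trans ltr01).
Qed.

Lemma duration_le_estimate (j : 'I_n) : (dur j)%:R <= mu1 * est j.
Proof. by case: dist => _ _ /(_ j)/andP[_]; rewrite floor_ge_int -pmulrn. Qed.

Lemma job_guess_le (j : 'I_n) : (job_guess j <= ceil_log2 mu1)%N.
Proof.
apply/bigmax_leqP => k _; apply: leq_ceil_log2.
rewrite ler_pdivrMr ?estimate_gt0 //.
by apply: le_trans (duration_le_estimate k); rewrite ler_nat geq_minl.
Qed.

Lemma elapsed_le_guess (k j : 'I_n) : (k <= j)%N ->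
  (minn (dur k) ((arr j).+1 - arr k))%:R <= 2 ^+ job_guess j * est k.
Proof.
move=> kj; rewrite -ler_pdivrMr ?estimate_gt0 // -ceil_log2_leq.
exact: (@leq_bigmax_cond _ (fun k : 'I_n => (k <= j)%N) (fun k => ceil_log2 _)).
Qed.

Lemma job_lengthE (j : 'I_n) :
  (job_length j)%:R = 2 ^+ job_guess j * 2 ^+ ceil_log2 (est j) :> R.
Proof. by rewrite natrX exprD. Qed.

Lemma job_length_gt0 (j : 'I_n) : (0 < job_length j)%N.
Proof. by rewrite expn_gt0. Qed.

Lemma job_length_le (j : 'I_n) :
  (job_length j)%:R <= 2 ^+ job_guess j * (2 * mu2) * (dur j)%:R.
Proof.
rewrite job_lengthE -[leRHS]mulrA ler_wpM2l ?exprn_ge0 // -mulrA.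
have est1 : 1 <= est j by case: valid.
rewrite (le_trans (exp_ceil_log2_le est1)) // ler_wpM2l //.
exact: estimate_le_duration.
Qed.

(* Otherwise the time that [k] has already spent would refute the guess. *)
Lemma alive_within_job_length (k j : 'I_n) : (k <= j)%N ->
  job_guess k = job_guess j -> (arr j < arr k + dur k)%N ->
  (arr j < arr k + job_length k)%N.
Proof.
move=> kj guessE jk; have elapsedE :
    minn (dur k) ((arr j).+1 - arr k) = ((arr j).+1 - arr k)%N by lia.
have := elapsed_le_guess kj; rewrite elapsedE -guessE => elapsed_le.
suff : ((arr j).+1 - arr k <= job_length k)%N by lia.
rewrite -(ler_nat R) job_lengthE (le_trans elapsed_le) //.
rewrite ler_wpM2l ?exprn_ge0 //.
exact: le_exp_ceil_log2.
Qed.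

Definition last_arrival (g t : nat) : nat :=
  \max_(k < n | (job_guess k == g) && (arr k < t)%N) arr k.

(* When the last job with a given guess arrived, the guess was not refuted. *)
Lemma alive_last_arrival (k : 'I_n) t : alive (jobs I k) t ->
  in_slots (arr k) (job_length k) (last_arrival (job_guess k) t).+1.
Proof.
move=> /andP[kt tk]; pose earlier (j : 'I_n) :=
  (job_guess j == job_guess k) && (arr j < t)%N.
have ek : earlier k by rewrite /earlier eqxx.
have k_le : (arr k <= last_arrival (job_guess k) t)%N.
  exact: (@leq_bigmax_cond _ earlier (fun j => arr j)).
rewrite /in_slots ltnS k_le /=.
have [|j /andP[/eqP guessE jt] lastE] :=
    @eq_bigmax_cond _ earlier (fun j => arr j).
  by apply/card_gt0P; exists k.
rewrite /last_arrival lastE in k_le *.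
have [kj|/ltnW jk] := leqP k j.
  by apply: alive_within_job_length => //; exact: leq_trans tk.
by have := arrival_mono jk; have := job_length_gt0 k; lia.
Qed.

End DistortionBounds.

Section BalanceLoad.
Variables (R : realType) (m : nat) (i0 : 'I_m) (p : R) (I : instance R m).
Variables (mu1 mu2 V : R) (o : 'I_(njobs I) -> 'I_m).
Hypothesis p_ge1 : 1 <= p.
Hypothesis valid : valid_instance I.
Hypothesis dist : distortion_bounds I mu1 mu2.

Local Notation n := (njobs I).
Local Notation assignment := (run (balance i0 p) (I := I)).

Definition real_load (f : 'I_n -> 'I_m) (t : nat) : 'I_m -> R :=
  assigned_load (@job_weight R m I) (fun k => alive (jobs I k) t) f.

Hypothesis o_finite : forall j, (load (jobs I j) (o j) < +oo)%E.
Hypothesis o_load_le : forall t, pnorm p (real_load o t) <= V.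

Let mu2_ge1 : 1 <= mu2. Proof. by case: dist. Qed.

Definition group_bound (g c : nat) : R :=
  8 * (2 ^+ g * (2 * mu2)) * (class_exponent p c)%:R * V.

Lemma group_load_le (key : group_key) (t : nat) :
  pnorm p (job_planned_load i0 p I key n t) <=
  group_bound (key_guess key) (key_class key).
Proof.
have guess_ge1 : 1 <= 2 ^+ key_guess key :> R by rewrite exprn_ege1 // ler1n.
have l1 : 1 <= 2 ^+ key_guess key * (2 * mu2).
  by rewrite mulr_ege1 //; have := mu2_ge1; lra.
set L := class_length p (key_class key); rewrite /group_bound /job_planned_load.
apply: (@greedy_pnorm_le R m n p (class_exponent p (key_class key)) _ _
  (fun j => minn (job_length j) (duration (jobs I j))) _ _ _ o
  (key_block key * L) (key_block key * L + L.*2)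
  (2 ^+ key_guess key * (2 * mu2)) V p_ge1 _ _ _ _ _ _ l1).
- apply: (le_trans (base_exponent_ge p)); rewrite ler_nat /class_exponent.
  by rewrite -addn2 (leq_trans _ (leq_addr _ _)) // leq_pmulr // expn_gt0.
- by rewrite addKn /class_exponent !expnS -!mul2n mulnA.
- exact: job_weight_ge0.
- exact: arrival_mono.
- move=> j /eqP groupE.
  have blockE : key_block key = (arrival (jobs I j) %/ L)%N.
    by rewrite /L -groupE.
  have len_le : (job_length j <= L)%N.
    by rewrite /L -groupE; exact: (task_length_le p (job_task j)).
  have L0 : (0 < L)%N by rewrite expn_gt0.
  rewrite blockE; have := leq_divM (arrival (jobs I j)) L.
  by have := ltn_ceil (arrival (jobs I j)) L0; split; lia.
- by move=> j _; rewrite leq_min job_length_gt0 duration_gt0 // geq_minl.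
- move=> j /eqP <-; rewrite /minn.
  case: ifP => _; last exact: (job_length_le valid dist).
  by rewrite ler_peMl // mulr_ege1 ?exprn_ege1 ?ler1n //; have := mu2_ge1; lra.
- move=> j /eqP groupE.
  have := run_balance_greedy i0 p (arrival_mono valid) (o_finite j).
  by rewrite -groupE.
- move=> s; apply: le_trans (o_load_le s); apply: le_pnorm => // i.
    exact/assigned_load_ge0/job_weight_ge0.
  apply: le_assigned_load => [|k /andP[_ /andP[ks sk]]].
    exact: job_weight_ge0.
  by rewrite /alive ks (leq_trans sk) // leq_add2l geq_minr.
Qed.

Let K := ceil_log2 mu1.
Let C := size_class p (K + ceil_log2 (max_estimate I)).

(* A job of a group is alive only in the block of its arrival and in the next
   one.  In block 0 both groups coincide. *)
Definition active_group (t : nat) (x : 'I_K.+1 * 'I_C.+1 * bool) : group_key :=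
  let: (g, c, previous) := x in
  (g : nat, c : nat, last_arrival I g t %/ class_length p c - previous)%N.

Lemma alive_active_group (t : nat) (k : 'I_n) : alive (jobs I k) t ->
  exists x, job_group p k = active_group t x.
Proof.
move=> /(alive_last_arrival valid); set s := last_arrival _ _ _ => alive_s.
have gK : (job_guess k < K.+1)%N by rewrite ltnS (job_guess_le valid dist).
have cC : (task_class p (job_task k) < C.+1)%N.
  rewrite ltnS; apply/leq_ceil_log2; rewrite ler_pM2r ?invr_gt0 // ler_nat.
  by rewrite leq_add // leq_ceil_log2 // le_max_estimate.
pose c := Ordinal cC; set L := class_length p c.
have L0 : (0 < L)%N by rewrite expn_gt0.
pose b := (arrival (jobs I k) %/ L)%N.
have b_le : (b <= s %/ L)%N by apply: leq_div2r; case/andP: alive_s.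
have le_b : (s %/ L <= b.+1)%N.
  have -> : b.+1 = ((arrival (jobs I k) + L) %/ L)%N.
    by rewrite divnDr // divnn L0 addn1.
  apply: leq_div2r; case/andP: alive_s => _ /ltnW/leq_trans; apply.
  by rewrite leq_add2l (task_length_le p (job_task k)).
exists (Ordinal gK, c, b != s %/ L)%N; congr (_, _, _); rewrite -/b -/s -/L.
by case: eqP => [<-|] /=; lia.
Qed.

Lemma balance_load_le_sum (t : nat) :
  pnorm p (real_load assignment t) <=
  \sum_(x : 'I_K.+1 * 'I_C.+1 * bool) group_bound x.1.1 x.1.2.
Proof.
pose load x := job_planned_load i0 p I (active_group t x) n
  (last_arrival I x.1.1 t).+1.
have load_ge0 x : nonneg (load x) by exact/assigned_load_ge0/job_weight_ge0.
apply: (@le_trans _ _ (\sum_x pnorm p (load x))); last first.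
  apply: ler_sum => -[[g c] e] _.
  exact: (group_load_le (active_group t (g, c, e))).
apply: le_trans (ler_pnorm_sum p_ge1 _ load_ge0); apply: le_pnorm => // i.
  exact/assigned_load_ge0/job_weight_ge0.
apply: ler_sum_cover => [k|k /andP[alive_k ai]]; first exact: job_weight_ge0.
have [x groupE] := alive_active_group alive_k; exists x.
rewrite ltn_ord groupE eqxx ai andbT /=.
have -> : x.1.1 = job_guess k :> nat by case: x groupE => [[g c] e] [].
exact: alive_last_arrival.
Qed.

Lemma sum_group_bound_le :
  \sum_(x : 'I_K.+1 * 'I_C.+1 * bool) group_bound x.1.1 x.1.2 <=
  384 * mu2 * 2 ^+ K * (class_log_length p C)%:R * V.
Proof.
have V0 : 0 <= V by apply: le_trans (o_load_le 0); exact: pnorm_ge0.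
have mu2_ge0 : 0 <= mu2 by rewrite (le_trans ler01).
rewrite -(pair_bigA _ (fun (y : 'I_K.+1 * 'I_C.+1) (_ : bool) =>
  group_bound y.1 y.2)) /=.
under eq_bigr do rewrite sumr_const card_bool.
rewrite -(pair_bigA _ (fun (g : 'I_K.+1) (c : 'I_C.+1) =>
  group_bound g c *+ 2)) /=.
have -> : \sum_(g < K.+1) \sum_(c < C.+1) group_bound g c *+ 2 =
    32 * mu2 * V *
      ((\sum_(g < K.+1) 2 ^+ g) * \sum_(c < C.+1) (class_exponent p c)%:R).
  rewrite big_distrlr /= mulr_sumr; apply: eq_bigr => g _.
  by rewrite mulr_sumr; apply: eq_bigr => c _; rewrite /group_bound; ring.
have -> : 384 * mu2 * 2 ^+ K * (class_log_length p C)%:R * V =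
  32 * mu2 * V * ((2 * 2 ^+ K) * (6 * (class_log_length p C)%:R)) by ring.
apply: ler_wpM2l; first by rewrite !mulr_ge0.
apply: ler_pM; rewrite ?sum_exp2_le ?sum_class_exponent_le ?sumr_ge0 //.
Qed.

Lemma balance_load_le (t : nat) : pnorm p (real_load assignment t) <=
  balance_ratio p (mu1 * mu2) (max_estimate I) * V.
Proof.
apply: (le_trans (balance_load_le_sum t)); apply: (le_trans sum_group_bound_le).
have [mu1_ge1 _ _] := dist.
rewrite ler_wpM2r ?balance_ratio_ge ?bigmax_ge_id //.
by apply: le_trans (o_load_le 0); exact: pnorm_ge0.
Qed.

End BalanceLoad.

(** * Norms of extended load vectors *)

Section ExtendedNorms.
Variables (R : realType) (m : nat) (p : R).
Hypothesis p_ge1 : 1 <= p.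
Implicit Types (x : 'I_m -> \bar R).

Let p_gt0 : 0 < p := lt_le_trans ltr01 p_ge1.

Lemma lp_norm_EFin (y : 'I_m -> R) :
  lp_norm p (fun i => (y i)%:E) = (pnorm p y)%:E.
Proof. by rewrite /lp_norm /pnorm -poweR_EFin -sumEFin. Qed.

Lemma lp_norm_ge0 x : (0 <= lp_norm p x)%E.
Proof. exact: poweR_ge0. Qed.

Lemma le_lp_norm x i : (0 <= x i)%E -> (x i <= lp_norm p x)%E.
Proof.
move=> x0; have -> : x i = ((x i `^ p) `^ p^-1)%E.
  by rewrite -poweRrM mulfV ?gt_eqF // poweRe1.
have pow_ge0 j : (0 <= x j `^ p)%E by exact: poweR_ge0.
apply: gt0_ler_poweR; rewrite ?invr_ge0 ?(ltW p_gt0) // ?in_itv /= ?leey ?andbT.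
- exact: pow_ge0.
- exact: sume_ge0.
- by rewrite (bigD1 i) //= leeDl // sume_ge0.
Qed.

Lemma linf_norm_le_lp_norm x : (forall i, 0 <= x i)%E ->
  (linf_norm x <= lp_norm p x)%E.
Proof.
move=> x0; apply: bigmax_le => [|i _]; first exact: lp_norm_ge0.
exact: le_lp_norm.
Qed.

Lemma lp_norm_le_linf_norm x : (0 < m)%N -> ln m%:R <= p ->
  (forall i, 0 <= x i)%E -> (lp_norm p x <= (expR 1)%:E * linf_norm x)%E.
Proof.
move=> m0 mp x0; have x_le i : (x i <= linf_norm x)%E by exact: le_bigmax.
have : (0 <= linf_norm x)%E by exact: bigmax_ge_id.
case: (linf_norm x) x_le => [M| |] // x_le M0; last first.
  by rewrite gt0_muley ?lte_fin ?expR_gt0 // leey.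
rewrite lee_fin in M0.
have xE i : x i = (fine (x i))%:E.
  by rewrite fineK // ge0_fin_numE // (le_lt_trans (x_le i)) // ltry.
rewrite (funext xE) lp_norm_EFin -EFinM lee_fin.
apply/pnorm_leP; rewrite ?mulr_ge0 ?expR_ge0 //.
apply: (@le_trans _ _ (\sum_(i < m) M `^ p)).
  apply: ler_sum => i _; apply: ler_powR_base; [exact: ltW|exact: fine_ge0|].
  by rewrite -lee_fin -xE.
rewrite sumr_const card_ord powRM ?expR_ge0 // -[leLHS]mulr_natl.
rewrite ler_wpM2r ?powR_ge0 // -ler_ln ?posrE ?powR_gt0 ?expR_gt0 ?ltr0n //.
by rewrite ln_powR expRK mulr1.
Qed.

End ExtendedNorms.

(** * Objective values and competitive ratios *)

Section Objective.
Variables (R : realType) (m : nat) (I : instance R m).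
Hypothesis valid : valid_instance I.
Implicit Types (norm : ('I_m -> \bar R) -> \bar R) (f : 'I_(njobs I) -> 'I_m).

Lemma norm_le_objective norm f t :
  (1 <= t < horizon I + max_duration I)%N ->
  (norm (machine_load f t) <= objective norm f)%E.
Proof.
move=> t_range; apply: (le_bigmax_seq _ t) => //.
by rewrite mem_index_iota.
Qed.

Lemma objective_le norm f (c : \bar R) : (0 <= c)%E ->
  (forall t, (1 <= t < horizon I + max_duration I)%N ->
    (norm (machine_load f t) <= c)%E) ->
  (objective norm f <= c)%E.
Proof.
move=> c0 norm_le; rewrite /objective big_nat_cond.
by apply: bigmax_le => // t /andP[/norm_le].
Qed.

Lemma objective_ge0 norm f : (0 <= objective norm f)%E.
Proof. exact: bigmax_ge_id. Qed.

Lemma opt_ge0 norm : (0 <= opt norm I)%E.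
Proof.
by apply: le_bigmin => [|f _]; [exact: leey|exact: objective_ge0].
Qed.

Lemma opt_le norm (f : {ffun 'I_(njobs I) -> 'I_m}) :
  (opt norm I <= objective norm f)%E.
Proof. exact: bigmin_le. Qed.

Lemma le_mul_opt norm (c : R) (x : \bar R) : 0 < c ->
  (forall f, x <= c%:E * objective norm f)%E -> (x <= c%:E * opt norm I)%E.
Proof.
move=> c0 x_le; rewrite /opt.
elim/big_ind: _ => [|y z xy xz|f _]; last exact: x_le.
- by rewrite gt0_muley ?lte_fin // leey.
- by rewrite /Order.min; case: ifP.
Qed.

Lemma machine_load_ge0 f t i : (0 <= machine_load f t i)%E.
Proof. by case: valid => _ _ _ _ load_ge0; exact: sume_ge0. Qed.

Lemma le_objective norm norm' f (e : R) : 0 <= e ->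
  (forall x, (forall i, 0 <= x i)%E -> norm x <= e%:E * norm' x)%E ->
  (objective norm f <= e%:E * objective norm' f)%E.
Proof.
move=> e0 norm_le; apply: objective_le.
  by rewrite mule_ge0 ?lee_fin ?objective_ge0.
move=> t t_range; apply: (le_trans (norm_le _ (machine_load_ge0 f t))).
by rewrite lee_wpmul2l ?lee_fin ?norm_le_objective.
Qed.

Lemma alive_in_range (j : 'I_(njobs I)) t : alive (jobs I j) t ->
  (1 <= t < horizon I + max_duration I)%N.
Proof.
case: valid => /(_ j) arr_lt _ /(_ j)/andP[_ dur_le] _ _ /andP[? ?]; lia.
Qed.

Lemma machine_loadE f t : (forall j, load (jobs I j) (f j) < +oo)%E ->
  machine_load f t = fun i => (real_load f t i)%:E.
Proof.
move=> f_finite; apply/funext => i.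
rewrite /machine_load /real_load /assigned_load -sumEFin.
apply: eq_big => [j|j /andP[/eqP <- _]]; first by rewrite andbC.
by rewrite fineK // ge0_fin_numE //; case: valid.
Qed.

Lemma finite_objective_load (p : R) f : 1 <= p ->
  (objective (lp_norm p) f < +oo)%E ->
  forall j, (load (jobs I j) (f j) < +oo)%E.
Proof.
move=> p1 obj_fin j; apply: le_lt_trans obj_fin.
set t := (arrival (jobs I j)).+1.
have [_ _ dur_range _ load_ge0] := valid.
have alive_t : alive (jobs I j) t.
  by have := dur_range j; rewrite /alive /t; lia.
apply: le_trans (norm_le_objective _ _ (alive_in_range alive_t)).
apply: le_trans (le_lp_norm p1 (machine_load_ge0 f t (f j))).
rewrite /machine_load (bigD1 j) /=; last by rewrite eqxx.
by rewrite leeDl // sume_ge0.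
Qed.

Lemma real_load_le_objective (p V : R) f : 1 <= p ->
  objective (lp_norm p) f = V%:E -> forall t, pnorm p (real_load f t) <= V.
Proof.
move=> p1 objE t; have obj_ge0 := objective_ge0 (lp_norm p) f.
have [t_range|t_out] := boolP (1 <= t < horizon I + max_duration I)%N.
  have f_finite : forall j, (load (jobs I j) (f j) < +oo)%E.
    by apply: (finite_objective_load p1); rewrite objE ltry.
  rewrite -lee_fin -objE -lp_norm_EFin -machine_loadE //.
  exact: norm_le_objective.
rewrite /real_load assigned_load_pred0 ?pnorm0 -?lee_fin -?objE // => j.
by apply: contraNF t_out => /alive_in_range.
Qed.

End Objective.

Section Competitive.
Variables (R : realType) (m : nat) (alg : online_algorithm R m).
Implicit Types (norm : ('I_m -> \bar R) -> \bar R) (c : R -> R -> R).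

Lemma competitive_le norm c c' :
  (forall mu D, 1 <= mu -> 1 <= D -> c mu D <= c' mu D) ->
  competitive norm alg c -> competitive norm alg c'.
Proof.
move=> cc' comp I mu1 mu2 valid dist; apply: (le_trans (comp I _ _ valid dist)).
have [mu1_ge1 mu2_ge1 _] := dist.
by rewrite lee_wpmul2r ?opt_ge0 ?lee_fin ?cc' ?mulr_ege1 ?bigmax_ge_id.
Qed.

Lemma competitive_norm_equiv norm norm' c (e : R) : 0 < e ->
  (forall mu D, 1 <= mu -> 1 <= D -> 0 <= c mu D) ->
  (forall x, (forall i, 0 <= x i)%E -> norm x <= norm' x)%E ->
  (forall x, (forall i, 0 <= x i)%E -> norm' x <= e%:E * norm x)%E ->
  competitive norm' alg c -> competitive norm alg (fun mu D => c mu D * e).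
Proof.
move=> e0 c0 le_norm le_norm' comp I mu1 mu2 valid dist.
have [mu1_ge1 mu2_ge1 _] := dist.
have obj_le : (objective norm (run alg (I := I)) <=
    objective norm' (run alg (I := I)))%E.
  rewrite -[leRHS]mul1e; apply: le_objective => // x x0.
  by rewrite mul1e le_norm.
apply: (le_trans obj_le); apply: (le_trans (comp I _ _ valid dist)).
rewrite EFinM -muleA lee_wpmul2l ?lee_fin ?c0 ?mulr_ege1 ?bigmax_ge_id //.
apply: le_mul_opt => // f.
apply: (le_trans (opt_le norm' (finfun f))).
have -> : (finfun f : _ -> _) = f by apply/funext => j; rewrite ffunE.
by apply: le_objective => //; exact: ltW.
Qed.

End Competitive.

Lemma balance_competitive (R : realType) (m : nat) (i0 : 'I_m) (p : R) :
  1 <= p -> competitive (lp_norm p) (balance i0 p) (balance_ratio p).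
Proof.
move=> p1 I mu1 mu2 valid dist; have [mu1_ge1 mu2_ge1 _] := dist.
have ratio_gt0 : 0 < balance_ratio p (mu1 * mu2) (max_estimate I).
  by rewrite balance_ratio_gt0 ?mulr_ege1 ?bigmax_ge_id.
apply: le_mul_opt => // o; have := objective_ge0 (lp_norm p) o.
case objE : (objective (lp_norm p) o) => [V| |] // V0; last first.
  by rewrite gt0_muley ?lte_fin // leey.
have o_finite : forall j, (load (jobs I j) (o j) < +oo)%E.
  by apply: (finite_objective_load valid p1); rewrite objE ltry.
have o_load_le := real_load_le_objective valid p1 objE.
rewrite -EFinM; apply: objective_le => [|t _].
  by rewrite lee_fin mulr_ge0 // ltW.
rewrite machine_loadE // => [|j].
  rewrite lp_norm_EFin lee_fin.
  exact: balance_load_le valid dist o_finite o_load_le t.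
exact: (run_balance_finite i0 p (o_finite j)).
Qed.

Theorem theorem1 (R : realType) :
  (exists2 C : R, 0 < C &
    forall (p : R) (m : nat), 1 <= p -> (0 < m)%N ->
      exists alg : online_algorithm R m,
        competitive (lp_norm p) alg
          (fun mu Dt => C * (mu * (p + ln (mu * Dt))))) /\
  (exists2 C : R, 0 < C &
    forall m : nat, (0 < m)%N ->
      exists alg : online_algorithm R m,
        competitive (@linf_norm R m) alg
          (fun mu Dt => C * (mu * Num.max 1 (ln (m%:R * mu * Dt))))).
Proof.
split.
  exists (384 * 20) => [|p m p1 m0]; first by rewrite mulr_gt0 ?ltr0n.
  by exists (balance (Ordinal m0) p); exact: balance_competitive.
exists (384 * 20 * 2 * expR 1) => [|m m0].
  by rewrite !mulr_gt0 ?expR_gt0 ?ltr0n.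
pose p : R := Num.max 1 (ln m%:R).
have p1 : 1 <= p by rewrite le_max lexx.
have ln_m_le : ln m%:R <= p by rewrite le_max lexx orbT.
exists (balance (Ordinal m0) p).
apply: (@competitive_le _ _ _ _ (fun mu D => balance_ratio p mu D * expR 1)).
  move=> mu D mu_ge1 D_ge1; rewrite [leRHS]mulrAC ler_wpM2r ?expR_ge0 //.
  exact: balance_ratio_ln_le.
apply: (competitive_norm_equiv (expR_gt0 1) _ _ _
  (balance_competitive (Ordinal m0) p1)).
- by move=> mu D mu_ge1 D_ge1; rewrite ltW // balance_ratio_gt0.
- by move=> x; exact: linf_norm_le_lp_norm.
- by move=> x; exact: lp_norm_le_linf_norm.
Qed.
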